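(* Let $d\ge 15$ and let $F_\infty$ be the CDF of the limiting distribution of the value $V_n$ of the noisy min-max game (with zero boundary conditions) as $n\to\infty$. Then the invariant recursive tree process corresponding to $F_\infty$ is endogenous.
   Context: On the infinite rooted $d$-ary tree $\mathbb{T}_d$ with root $\rho$, put i.i.d. cookies $X_e$ uniform on $\{-1,+1\}$ on the edges; $N(v)$ is the set of children of $v$, and for $u\neq\rho$, $X_u$ is the cookie on the edge between $u$ and its parent. The level (height) of a vertex is its distance from $\rho$; $v$ is even if its level is even. For $n\ge0$ set $V_n(v)=0$ for $v$ at level $2n$, and for $v$ at level less than $2n$ set $V_n(v)=\max_{u\in N(v)}(X_u+V_n(u))$ for $v$ even, $V_n(v)=\min_{u\in N(v)}(X_u+V_n(u))$ for $v$ odd; $V_n:=V_n(\rho)$. For $d\ge15$, $V_n$ converges almost surely as $n\to\infty$. Write $F_\infty$ for the CDF of its limit; it is invariant under the distributional recursion induced by one round of the game (max step after min step). The invariant recursive tree process (RTP) corresponding to $F_\infty$ is the (unique in law) family $\big((V_v)_{v\text{ even}},(X_e)_e\big)$ of random variables on a common probability space such that: $(X_e)$ are i.i.d. uniform on $\{-1,+1\}$; almost surely, for all even $v$, $$V_v=\max_{u\in N(v)}\Big(X_u+\min_{w\in N(u)}(X_w+V_w)\Big);$$ and for every $m\ge0$ the variables $(V_v)_{v\text{ at level }2m}$ are i.i.d. with CDF $F_\infty$ and are independent of the cookies on the edges of the first $2m$ levels (those between the root and level $2m$). The RTP is endogenous if $V_\rho$ is (almost surely equal to) a measurable function of the cookies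 $(X_e)_e$. *)

(* Defs.v *)
From HB Require Import structures.
From mathcomp Require Import all_boot all_order all_algebra finmap.
From mathcomp Require Import all_classical all_reals all_analysis.

Set Implicit Arguments.
Unset Strict Implicit.
Unset Printing Implicit Defensive.

Import Order.TTheory GRing.Theory Num.Theory.
Import numFieldNormedType.Exports.

Local Open Scope classical_set_scope.
Local Open Scope ring_scope.

(* A vertex is the list of the choices leading to it from the root, the most
   recent choice first: the root is [::], the children of v are the i :: v,
   and the level of v is size v. *)
Definition vertex (d : nat) := seq 'I_d.

(* (v, i) is the edge between v and its child i :: v. *)
Definition edge (d : nat) := (vertex d * 'I_d)%type.

(* The default value of the iterated operation is one of the values f i as
   soon as d > 0 (lemmas fmaxP and fminP). *)
Definition fmax (R : realType) (d : nat) (f : 'I_d -> R) : R :=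
  \big[Num.max/head 0 (codom f)]_(i < d) f i.
Definition fmin (R : realType) (d : nat) (f : 'I_d -> R) : R :=
  \big[Num.min/head 0 (codom f)]_(i < d) f i.

Lemma head_codom (R : realType) (d : nat) (f : 'I_d -> R) :
  (0 < d)%N -> exists i, head 0 (codom f) = f i.
Proof.
move=> d0; have : head 0 (codom f) \in codom f.
  have := size_codom f; rewrite card_ord.
  by case: (codom f) => [d00|a s _]; [rewrite -d00 in d0|exact: mem_head].
by case/codomP => i ->; exists i.
Qed.

Lemma fmaxP (R : realType) (d : nat) (f : 'I_d -> R) : (0 < d)%N ->
  (exists i, fmax f = f i) /\ (forall i, f i <= fmax f).
Proof.
move=> d0; split; last by move=> i; apply: le_bigmax.
rewrite /fmax; elim/big_ind: _ => [|x y [i ->] [j ->]|i _]; last by exists i.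
- exact: head_codom.
- by case: leP; [exists j|exists i].
Qed.

Lemma fminP (R : realType) (d : nat) (f : 'I_d -> R) : (0 < d)%N ->
  (exists i, fmin f = f i) /\ (forall i, fmin f <= f i).
Proof.
move=> d0; split; last by move=> i; apply: bigmin_le.
rewrite /fmin; elim/big_ind: _ => [|x y [i ->] [j ->]|i _]; last by exists i.
- exact: head_codom.
- by case: leP; [exists i|exists j].
Qed.

(* Value at v of the game with cookies x that stops, with value 0, after k
   further steps. *)
Fixpoint stopped_value (R : realType) (d : nat) (x : edge d -> R) (k : nat)
    (v : vertex d) : R :=
  if k is k'.+1 then
    let step (i : 'I_d) := x (v, i) + stopped_value x k' (i :: v) in
    if odd (size v) then fmin step else fmax step
  else 0.

(* V_n(v), for v at level at most 2n. *)
Definition game_value (R : realType) (d : nat) (x : edge d -> R) (n : nat)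
    (v : vertex d) : R :=
  stopped_value x (n.*2 - size v) v.

(* Mutual independence of the X i, i in D. *)
Definition independent_family (R : realType) (dT : measure_display)
    (T : measurableType dT) (P : probability T R) (I : choiceType)
    (D : set I) (X : I -> {RV P >-> R}) : Prop :=
  forall (J : {fset I}) (B : I -> set R), [set` J] `<=` D ->
    (forall i, measurable (B i)) ->
    P (\bigcap_(i in [set` J]) (X i @^-1` B i)) =
    (\prod_(i <- J) P (X i @^-1` B i))%E.

(* Generators of the sigma-algebra of the family (X i), i in D. *)
Definition family_events (R : realType) (T I : Type) (D : set I)
    (X : I -> T -> R) : set (set T) :=
  \bigcup_(i in D) preimage_set_system [set: T] (X i) measurable.

Definition independent_of (R : realType) (dT : measure_display)
    (T : measurableType dT) (P : probability T R) (I J : Type)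
    (D : set I) (X : I -> {RV P >-> R}) (E : set J) (Y : J -> {RV P >-> R}) :
    Prop :=
  forall A B : set T,
    <<s family_events D (fun i => X i : T -> R) >> A ->
    <<s family_events E (fun j => Y j : T -> R) >> B ->
    P (A `&` B) = (P A * P B)%E.

Record iid_cookies (R : realType) (d : nat) (dT : measure_display)
    (T : measurableType dT) (P : probability T R)
    (X : edge d -> {RV P >-> R}) : Prop := {
  cookies_independent : independent_family [set: edge d] X ;
  cookies_plus : forall e, P (X e @^-1` [set 1]) = (2^-1)%:E ;
  cookies_minus : forall e, P (X e @^-1` [set -1]) = (2^-1)%:E }.

(* limn is total: it takes an arbitrary default value where the sequence
   diverges, which for d >= 15 happens only on a null event. *)
Definition game_limit (R : realType) (d : nat) (x : edge d -> R) : R :=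
  limn (fun n => game_value x n [::]).

(* F_infty, computed from any realization X of the i.i.d. cookies. *)
Definition limit_cdf (R : realType) (d : nat) (dT : measure_display)
    (T : measurableType dT) (P : probability T R)
    (X : edge d -> {RV P >-> R}) (t : R) : \bar R :=
  P [set om | game_limit (fun e => X e om) <= t].

(* Only the V v with v even are part of the process; the V v with v odd are
   unconstrained. *)
Record invariant_rtp (R : realType) (d : nat) (dT : measure_display)
    (T : measurableType dT) (P : probability T R) (F : R -> \bar R)
    (V : vertex d -> {RV P >-> R}) (X : edge d -> {RV P >-> R}) : Prop := {
  rtp_cookies : iid_cookies X ;
  rtp_recursion : {ae P, forall om, forall v : vertex d, ~~ odd (size v) ->
    V v om = fmax (fun i : 'I_d => X (v, i) om +
               fmin (fun j : 'I_d => X (i :: v, j) om + V (j :: i :: v) om))} ;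
  rtp_level_independent : forall m : nat,
    independent_family [set v : vertex d | size v = m.*2] V ;
  rtp_level_cdf : forall (m : nat) (v : vertex d), size v = m.*2 ->
    forall t : R, cdf (V v) t = F t ;
  rtp_level_cookies : forall m : nat,
    independent_of [set v : vertex d | size v = m.*2] V
                   [set e : edge d | (size e.1 < m.*2)%N] X }.

(* Configurations of cookies, with the product sigma-algebra. *)
Definition cookie_space (R : realType) (d : nat) :=
  g_sigma_algebraType
    (family_events [set: edge d] (fun (e : edge d) (x : edge d -> R) => x e)).

Definition endogenous (R : realType) (d : nat) (dT : measure_display)
    (T : measurableType dT) (P : probability T R)
    (V : vertex d -> {RV P >-> R}) (X : edge d -> {RV P >-> R}) : Prop :=
  exists g : cookie_space R d -> R, measurable_fun [set: cookie_space R d] g /\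
    {ae P, forall om, V [::] om = g (fun e => X e om)}.

(* Main.v *)
Require Import Defs.
From mathcomp Require Import all_boot all_order all_algebra finmap.
From mathcomp Require Import all_classical all_reals all_analysis.
From mathcomp Require Import measurable_realfun.
From mathcomp Require Import ring lra zify.

(* Stop the game after n rounds. Three facts about large d make its value
   V_n coincide with V_rho for all large n, almost surely.
   (1) A subgame value can be nonzero only on a "bad" event. A round is bad
   when every even step is -1 or is followed by a bad subgame, or when under
   some even step every odd step is +1 or leads to a bad subgame. Starting
   from leaves that are bad with probability at most 2 d / 2^d, this bound
   reproduces itself. It holds for the game with zero boundary, hence (by
   Fatou) for its limit law F_infty, hence for the V_v at any even level.
   (2) If V_n and V disagree at the root, they disagree at some grandchild
   w = j :: i :: [::] which is pivotal: either all the other even steps are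
   stuck (-1, or followed by a bad subgame), or all the other odd steps under
   i are loose (+1, or leading to a bad subgame). Since pivotality is
   independent of the subgame at w and has probability O(2^-d), the union
   bound over the d^2 grandchildren halves the probability of disagreement at
   each round.
   (3) Therefore P(V_n <> V_rho) <= 2^-n, and Borel-Cantelli applies.
   All the events involved depend on finitely many booleans (the signs of the
   cookies and the leaf events V_v <> 0), so that the probabilities are finite
   sums over the type of all the configurations of a game with k rounds. *)

Set Implicit Arguments.
Unset Strict Implicit.
Unset Printing Implicit Defensive.

Import Order.TTheory GRing.Theory Num.Theory.
Import numFieldNormedType.Exports.

Local Open Scope classical_set_scope.
Local Open Scope ring_scope.

(** * Finite weighted types *)

Section FiniteMass.
Variable R : realFieldType.
Implicit Types T I : finType.

Definition mass T (w : T -> R) (A : pred T) : R := \sum_(t | A t) w t.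

Definition prob_weight T (w : T -> R) : Prop :=
  (forall t, 0 <= w t) /\ mass w predT = 1.

(** Law of a fair bit paired with an independent point of law [w]. *)
Definition coin_weight T (w : T -> R) (x : bool * T) : R := 2^-1 * w x.2.

Definition power_weight (d : nat) T (w : T -> R) (f : {ffun 'I_d -> T}) : R :=
  \prod_i w (f i).

Lemma mass_ge0 T (w : T -> R) (A : pred T) : prob_weight w -> 0 <= mass w A.
Proof. by case=> w0 _; apply: sumr_ge0. Qed.

Lemma eq_mass T (w : T -> R) (A B : pred T) : A =1 B -> mass w A = mass w B.
Proof. exact: eq_bigl. Qed.

Lemma mass_exists T I (w : T -> R) (A : I -> pred T) : prob_weight w ->
  mass w (fun t => [exists i, A i t]) <= \sum_i mass w (A i).
Proof.
move=> [w0 _]; under [leRHS]eq_bigr do rewrite /mass big_mkcond/=.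
rewrite exchange_big /mass big_mkcond/=.
apply: ler_sum => t _; case: existsP => [[i Ait]|_].
  by rewrite (bigD1 i)//= Ait lerDl sumr_ge0// => j _; case: ifP.
by apply: sumr_ge0 => j _; case: ifP.
Qed.

Lemma mass_or T (w : T -> R) (A B : pred T) : prob_weight w ->
  mass w (fun t => A t || B t) <= mass w A + mass w B.
Proof.
move=> [w0 _]; rewrite /mass big_mkcond [X in _ <= X + _]big_mkcond.
rewrite [X in _ <= _ + X]big_mkcond -big_split/=.
by apply: ler_sum => t _; case: (A t); case: (B t) => /=;
  rewrite ?addr0 ?add0r ?lerDl.
Qed.

Lemma mass_coin T (w : T -> R) (A : bool -> pred T) :
  mass (coin_weight w) (fun x => A x.1 x.2) =
  2^-1 * (mass w (A true) + mass w (A false)).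
Proof.
rewrite /mass.
rewrite -(pair_big_dep predT (fun b t => A b t) (fun b t => 2^-1 * w t))/=.
by rewrite big_bool/= -!mulr_sumr -mulrDr.
Qed.

Lemma mass_coin2 T (w : T -> R) (A : pred T) :
  mass (coin_weight w) (fun x => A x.2) = mass w A.
Proof. by rewrite (mass_coin w (fun _ => A)); field. Qed.

Lemma prob_weight_coin T (w : T -> R) :
  prob_weight w -> prob_weight (coin_weight w).
Proof.
move=> [w0 w1]; split; first by move=> x; rewrite mulr_ge0// invr_ge0.
by rewrite -w1 -(mass_coin2 w predT).
Qed.

(** One value of the bit makes the event certain, the other reduces it to [A]; [b] says which. *)
Lemma mass_coin_or T (w : T -> R) (A : pred T) (b : bool) : prob_weight w ->
  mass (coin_weight w) (fun x => (x.1 (+) b) || A x.2) = 2^-1 * (1 + mass w A).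
Proof.
move=> [_ w1]; rewrite (mass_coin w (fun c t => (c (+) b) || A t)) -w1.
by case: b => /=; rewrite [in LHS]addrC // addrC.
Qed.

Lemma mass_power (d : nat) T (w : T -> R) (A : 'I_d -> pred T) :
  mass (@power_weight d T w) (fun f => [forall i, A i (f i)]) =
  \prod_i mass w (A i).
Proof.
rewrite /mass (bigA_distr_big_dep A (fun=> w)).
by apply: eq_bigl => f; apply/forallP/familyP.
Qed.

Lemma prob_weight_power d T (w : T -> R) :
  prob_weight w -> prob_weight (@power_weight d T w).
Proof.
move=> [w0 w1]; split; first by move=> f; apply: prodr_ge0.
rewrite -(@eq_mass _ _ (fun f : {ffun _} => [forall i, predT (f i)])).
  by rewrite (mass_power w (fun=> predT)) big1.
by move=> f; apply/forallP.
Qed.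

Arguments prob_weight_power [d T w].

Lemma mass_power_forall d T (w : T -> R) (A : pred T) :
  mass (@power_weight d T w) (fun f => [forall i, A (f i)]) = mass w A ^+ d.
Proof. by rewrite (mass_power w (fun=> A)) prodr_const card_ord. Qed.

(** A product event, with [A] at coordinate i and [B] at the d - 1 others. This is the form in which
    pivotality is independent of the pivotal subgame. *)
Lemma mass_power_pivot d T (w : T -> R) (A B : pred T) (i : 'I_d) :
  mass (@power_weight d T w)
    (fun f : {ffun 'I_d -> T} => A (f i) && [forall j, (j != i) ==> B (f j)]) =
  mass w A * mass w B ^+ d.-1.
Proof.
rewrite (@eq_mass _ _ _
  (fun f : {ffun 'I_d -> T} =>
     [forall j, (if j == i then A else B) (f j)])); last first.
  move=> f; apply/andP/forallP => [[Ai /forallP B0] j|AB].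
    by have := B0 j; case: eqP => [->|].
  split; first by have := AB i; rewrite eqxx.
  by apply/forallP => j; have := AB j; case: eqP.
rewrite (mass_power w (fun j => if j == i then A else B)) (bigD1 i)//= eqxx.
congr (_ * _).
rewrite (eq_bigr (fun=> mass w B)); last by move=> j /negbTE ->.
by rewrite prodr_const cardC1 card_ord.
Qed.

Lemma mass_power_proj d T (w : T -> R) (A : pred T) (i : 'I_d) :
  prob_weight w ->
  mass (@power_weight d T w) (fun f => A (f i)) = mass w A.
Proof.
move=> [_ w1]; rewrite (@eq_mass _ _ _
  (fun f : {ffun 'I_d -> T} =>
     A (f i) && [forall j, (j != i) ==> predT (f j)])).
  by rewrite mass_power_pivot w1 expr1n mulr1.
move=> f /=; rewrite [X in _ = _ && X](_ : _ = true) ?andbT//.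
by apply/forallP => j; rewrite implybT.
Qed.

Lemma mass_power_exists d T (w : T -> R) (A : pred T) : prob_weight w ->
  mass (@power_weight d T w) (fun f => [exists i, A (f i)]) <= d%:R * mass w A.
Proof.
move=> w1.
apply: le_trans (mass_exists (fun i (f : {ffun 'I_d -> T}) => A (f i))
  (prob_weight_power w1)) _.
under eq_bigr do rewrite mass_power_proj//.
by rewrite sumr_const card_ord mulr_natl.
Qed.

Arguments mass_power_exists [d T w].
Arguments mass_power_forall [d T].

(** * One round on independent subgames *)

Section OneRound.
Variables (d : nat) (T : finType) (w : T -> R).
Hypothesis w1 : prob_weight w.

Local Notation column := {ffun 'I_d -> bool * T}.

(* In a pair (e, t), e = true encodes a cookie +1 on the edge above t; for the
   games with 0 rounds, true means that the leaf has a nonzero value. *)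
Definition round_conf : finType := {ffun 'I_d -> bool * column}.

Definition round_weight : round_conf -> R :=
  power_weight (coin_weight (power_weight (coin_weight w))).

Lemma prob_weight_round : prob_weight round_weight.
Proof.
exact/prob_weight_power/prob_weight_coin/prob_weight_power/prob_weight_coin.
Qed.

(** With [B] covering the subgames of nonzero value, an even step that is not stuck is worth at
    least 1 - 1 = 0, and an odd step that is not loose is worth -1, which caps the even step before
    it at 1 - 1 = 0. *)
Definition stuck (B : pred T) (x : bool * column) : bool :=
  ~~ x.1 || [exists j, B (x.2 j).2].
Definition loose (B : pred T) (y : bool * T) : bool := y.1 || B y.2.

Definition round_bad (B : pred T) (c : round_conf) : bool :=
  [forall i, stuck B (c i)] || [exists i, [forall j, loose B ((c i).2 j)]].

(** [A] marks the subgames in disagreement, [B] the bad ones. Both pivotality clauses leave out the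
    branch of the grandchild (i, j), hence are independent of its subgame. *)
Definition round_diff (A B : pred T) (c : round_conf) : bool :=
  [exists i, [exists j, A ((c i).2 j).2 &&
    ([forall i', (i' != i) ==> stuck B (c i')] ||
     [forall j', (j' != j) ==> loose B ((c i).2 j')])]].

Lemma mass_stuck (B : pred T) :
  mass (coin_weight (power_weight (coin_weight w))) (stuck B) <=
  2^-1 * (1 + d%:R * mass w B).
Proof.
rewrite (@eq_mass _ _ _ (fun x : bool * column =>
  (x.1 (+) true) || [exists j, B (x.2 j).2])); last first.
  by move=> x; rewrite addbT.
rewrite (mass_coin_or (fun g : column => [exists j, B (g j).2])); last first.
  exact/prob_weight_power/prob_weight_coin.
rewrite ler_pM2l ?invr_gt0// lerD2l.
rewrite -(mass_coin2 w B).
exact: (mass_power_exists (fun y => B y.2) (prob_weight_coin w1)).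
Qed.

Lemma mass_loose (B : pred T) :
  mass (coin_weight w) (loose B) = 2^-1 * (1 + mass w B).
Proof.
by rewrite -(mass_coin_or B false)//; apply: eq_mass => x; rewrite addbF.
Qed.

Lemma mass_round_bad (B : pred T) : mass round_weight (round_bad B) <=
  (2^-1 * (1 + d%:R * mass w B)) ^+ d + d%:R * (2^-1 * (1 + mass w B)) ^+ d.
Proof.
apply: le_trans (mass_or _ _ prob_weight_round) _; apply: lerD.
  rewrite (mass_power_forall _ (stuck B)).
  apply: lerXn2r; last exact: mass_stuck.
    apply: mass_ge0.
    exact/prob_weight_coin/prob_weight_power/prob_weight_coin.
  rewrite nnegrE mulr_ge0 ?invr_ge0// addr_ge0// mulr_ge0//.
  exact: mass_ge0.
apply: le_trans (mass_power_exists (fun x : bool * column =>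
  [forall j, loose B (x.2 j)]) _) _.
  exact/prob_weight_coin/prob_weight_power/prob_weight_coin.
rewrite ler_wpM2l// (mass_coin2 _
  (fun g : column => [forall j, loose B (g j)])).
by rewrite (mass_power_forall _ (loose B)) mass_loose.
Qed.

(** Union bound over the d^2 grandchildren and the two kinds of pivotality; each term factors by
    [mass_power_pivot], applied to the even steps for [stuck] and to the odd steps under i for
    [loose]. *)
Lemma mass_round_diff (A B : pred T) : mass round_weight (round_diff A B) <=
  d%:R ^+ 2 * (mass w A * ((2^-1 * (1 + d%:R * mass w B)) ^+ d.-1 +
                           (2^-1 * (1 + mass w B)) ^+ d.-1)).
Proof.
have pcol : prob_weight (power_weight (coin_weight w) : column -> R).
  exact/prob_weight_power/prob_weight_coin.
apply: le_trans (mass_exists _ prob_weight_round) _.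
have -> : forall z : R, d%:R ^+ 2 * z = \sum_(i < d) \sum_(j < d) z.
  move=> z; rewrite !sumr_const !card_ord -[RHS]mulr_natl -[z *+ d]mulr_natl.
  by rewrite mulrA expr2.
apply: ler_sum => i _; apply: le_trans (mass_exists _ prob_weight_round) _.
apply: ler_sum => j _.
rewrite (@eq_mass _ _ _ (fun c : round_conf =>
    (A ((c i).2 j).2 && [forall i', (i' != i) ==> stuck B (c i')]) ||
    (A ((c i).2 j).2 && [forall j', (j' != j) ==> loose B ((c i).2 j')])));
  last first.
  by move=> c; rewrite andb_orr.
apply: le_trans (mass_or _ _ prob_weight_round) _; rewrite mulrDr; apply: lerD.
  rewrite (mass_power_pivot _ (fun x : bool * column => A (x.2 j).2)
    (stuck B)).
  rewrite (mass_coin2 _ (fun g : column => A (g j).2)).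
  rewrite (mass_power_proj (fun y => A y.2) _ (prob_weight_coin w1)) mass_coin2.
  rewrite ler_wpM2l ?mass_ge0//; apply: lerXn2r; last exact: mass_stuck.
    by apply: mass_ge0; exact: prob_weight_coin.
  rewrite nnegrE mulr_ge0 ?invr_ge0// addr_ge0// mulr_ge0//.
  exact: mass_ge0.
rewrite (mass_power_proj (fun x : bool * column =>
  A (x.2 j).2 && [forall j', (j' != j) ==> loose B (x.2 j')]) _
  (prob_weight_coin pcol)).
rewrite (mass_coin2 _ (fun g : column =>
  A (g j).2 && [forall j', (j' != j) ==> loose B (g j')])).
rewrite (mass_power_pivot _ (fun y => A y.2) (loose B)) mass_coin2.
by rewrite mass_loose.
Qed.

End OneRound.

(** * Numerical estimates for d at least 15 *)

(** A reciprocal form of Bernoulli's inequality: the induction rests on (1 + y) (1 - (m + 1) y) <= 1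
    - m y. *)
Lemma exprD1_bound (y : R) (m : nat) :
  0 <= y -> (1 + y) ^+ m * (1 - m%:R * y) <= 1.
Proof.
move=> y0; elim: m => [|m IH]; first by rewrite expr0 mul0r subr0 mulr1.
apply: le_trans IH; rewrite exprSr -mulrA ler_wpM2l ?exprn_ge0 ?addr_ge0//.
rewrite -natr1; have := ler0n R m.
by move: (m%:R : R) => M M0; nra.
Qed.

(** The last hypothesis rearranges to 1 <= (1 - m y) u; multiply by the power and use
    [exprD1_bound]. *)
Lemma exprD1_le (y u : R) (m : nat) : 0 <= y -> 1 < u ->
  m%:R * y * u <= u - 1 -> (1 + y) ^+ m <= u.
Proof.
move=> y0 u1 h; have := exprD1_bound m y0.
have : 0 <= (1 + y) ^+ m by rewrite exprn_ge0// addr_ge0.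
set a := _ ^+ _; set b := m%:R * y in h *.
move=> a0 ab.
have b1 : 1 <= (1 - b) * u by nra.
have : a * ((1 - b) * u) <= u by rewrite mulrA ler_piMl//; lra.
by apply: le_trans; rewrite ler_peMr.
Qed.

(** Starts from 4 * 15^3 = 13500 <= 32768 = 2^15 and continues by (m + 1)^3 <= 2 m^3. *)
Lemma cube_le_exp2 (d : nat) : (15 <= d)%N -> (4 * d ^ 3 <= 2 ^ d)%N.
Proof.
move=> /subnKC <-; elim: (d - 15)%N => [//|n IH].
rewrite addnS expnS; apply: leq_trans (leq_mul (leqnn 2) IH).
set m := (15 + n)%N.
have m15 : (15 <= m)%N by rewrite leq_addr.
rewrite !expnS !expn0 !muln1; nia.
Qed.

Section Iteration.
Variable d : nat.
Hypothesis hd : (15 <= d)%N.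

(* To first order a round is bad with probability 2^-d + d 2^-d; the factor 2
   absorbs the contribution of the bad subgames. *)
Definition bad_bound : R := 2 * d%:R * 2 ^- d.

Lemma iteration_facts : [/\ (15 : R) <= d%:R, 0 < 2 ^- d :> R &
  4 * d%:R ^+ 3 * 2 ^- d <= 1 :> R].
Proof.
have p : 0 < 2 ^+ d :> R by rewrite exprn_gt0.
split; [by rewrite ler_nat|by rewrite invr_gt0|].
by rewrite ler_pdivrMr// mul1r -!natrX -natrM ler_nat cube_le_exp2.
Qed.

Lemma half_exp (y : R) (m : nat) :
  (2^-1 * (1 + y)) ^+ m = 2 ^- m * (1 + y) ^+ m.
Proof. by rewrite exprMn exprVn. Qed.

(** In [exprD1_le] with y = 2 d^2 2^-d and u = 2, the condition becomes 4 d^3 2^-d <= 1, which is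
    the source of the constant in [cube_le_exp2]. *)
Lemma stuck_exp_le (m : nat) : (m <= d)%N ->
  (1 + d%:R * bad_bound) ^+ m <= 2 :> R.
Proof.
move=> md; have [d15 x0 dx] := iteration_facts.
apply: exprD1_le; rewrite ?ltr1n// /bad_bound.
  by rewrite !mulr_ge0// ltW.
have m_d : (m%:R : R) <= d%:R by rewrite ler_nat.
have m0 := ler0n R m.
move: (2 ^- d) (d%:R : R) (m%:R : R) d15 x0 dx m_d m0 => x D M d15 x0 dx m_d m0.
have : M * (D * D * x) <= D * (D * D * x).
  by rewrite ler_wpM2r// !mulr_ge0//; lra.
by rewrite !exprS expr0 in dx; lra.
Qed.

(** Here y = 2 d 2^-d and u = 3/2: the condition follows from 3 d^2 2^-d <= 3 / (4 d) <= 1/2. *)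
Lemma loose_exp_le (m : nat) : (m <= d)%N ->
  (1 + bad_bound) ^+ m <= 3 / 2 :> R.
Proof.
move=> md; have [d15 x0 dx] := iteration_facts.
apply: exprD1_le; rewrite /bad_bound.
- by rewrite !mulr_ge0// ltW.
- lra.
have m_d : (m%:R : R) <= d%:R by rewrite ler_nat.
have m0 := ler0n R m.
move: (2 ^- d) (d%:R : R) (m%:R : R) d15 x0 dx m_d m0 => x D M d15 x0 dx m_d m0.
have : M * (D * x) <= D * (D * x).
  by rewrite ler_wpM2r// !mulr_ge0//; lra.
have : 15 * (D * D * x) <= D * (D * D * x).
  by rewrite ler_wpM2r// !mulr_ge0//; lra.
by rewrite !exprS expr0 in dx; lra.
Qed.

(** The two terms are at most 2 * 2^-d and (3/2) d 2^-d, and 2 <= d / 2. *)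
Lemma bad_bound_step (b : R) : 0 <= b <= bad_bound ->
  (2^-1 * (1 + d%:R * b)) ^+ d + d%:R * (2^-1 * (1 + b)) ^+ d <= bad_bound.
Proof.
move=> /andP[b0 bb]; rewrite !half_exp.
have [d15 x0 dx] := iteration_facts.
have h1 : (1 + d%:R * b) ^+ d <= 2.
  apply: le_trans (stuck_exp_le (leqnn d)); apply: lerXn2r.
  - by rewrite nnegrE addr_ge0// mulr_ge0.
  - by rewrite nnegrE addr_ge0// mulr_ge0// (le_trans b0).
  - by rewrite lerD2l ler_wpM2l.
have h2 : (1 + b) ^+ d <= 3 / 2.
  apply: le_trans (loose_exp_le (leqnn d)); apply: lerXn2r.
  - by rewrite nnegrE addr_ge0.
  - by rewrite nnegrE addr_ge0// (le_trans b0).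
  - by rewrite lerD2l.
rewrite /bad_bound; move: (_ ^+ d) ((1 + b) ^+ d) h1 h2 => u v h1 h2.
move: (2 ^- d) (d%:R : R) d15 x0 dx => x D d15 x0 dx.
have : x * u <= x * 2 by rewrite ler_pM2l.
have : (D * x) * v <= D * x * (3 / 2) by rewrite ler_pM2l// mulr_gt0//; lra.
have : 15 * x <= D * x by rewrite ler_pM2r.
lra.
Qed.

(** As 2^-(d-1) = 2 * 2^-d, the factor of a is at most d^2 * 2 * 2^-d * (2 + 3/2) = 7 d^2 2^-d <= 7
    / (4 d) <= 1/2. *)
Lemma diff_bound_step (a b : R) : 0 <= a -> 0 <= b <= bad_bound ->
  d%:R ^+ 2 * (a * ((2^-1 * (1 + d%:R * b)) ^+ d.-1 +
                           (2^-1 * (1 + b)) ^+ d.-1)) <= 2^-1 * a.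
Proof.
move=> a0 /andP[b0 bb]; rewrite !half_exp.
have [d15 x0 dx] := iteration_facts.
have h1 : (1 + d%:R * b) ^+ d.-1 <= 2.
  apply: le_trans (stuck_exp_le (leq_pred d)); apply: lerXn2r.
  - by rewrite nnegrE addr_ge0// mulr_ge0.
  - by rewrite nnegrE addr_ge0// mulr_ge0// (le_trans b0).
  - by rewrite lerD2l ler_wpM2l.
have h2 : (1 + b) ^+ d.-1 <= 3 / 2.
  apply: le_trans (loose_exp_le (leq_pred d)); apply: lerXn2r.
  - by rewrite nnegrE addr_ge0.
  - by rewrite nnegrE addr_ge0// (le_trans b0).
  - by rewrite lerD2l.
have -> : 2 ^- d.-1 = 2 * 2 ^- d :> R.
  rewrite -[in RHS](prednK (leq_trans _ hd : (0 < d)%N))//.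
  by rewrite exprS invfM mulrA mulfV ?mul1r ?pnatr_eq0.
rewrite -mulrDr; move: (_ ^+ d.-1) ((1 + b) ^+ d.-1) h1 h2 => u v h1 h2.
move: (2 ^- d) (d%:R : R) d15 x0 dx => x D d15 x0 dx.
have -> : D ^+ 2 * (a * (2 * x * (u + v))) =
    (D ^+ 2 * x * (2 * (u + v))) * a by ring.
apply: ler_wpM2r => //.
have D0 : 0 <= D by lra.
have y0 : 0 <= D ^+ 2 * x by rewrite mulr_ge0 ?exprn_ge0// ltW.
have : 15 * (D ^+ 2 * x) <= D * (D ^+ 2 * x) by rewrite ler_wpM2r.
rewrite [D * _]mulrA -exprS => y1.
have : D ^+ 2 * x * (2 * (u + v)) <= D ^+ 2 * x * 7 by rewrite ler_wpM2l//; lra.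
lra.
Qed.

Fixpoint game_conf (k : nat) : finType :=
  if k is k'.+1 then round_conf d (game_conf k') else bool.

Fixpoint game_weight (q : R) (k : nat) : game_conf k -> R :=
  if k is k'.+1 then round_weight (@game_weight q k')
  else fun b => if b then q else 1 - q.

Fixpoint game_bad (k : nat) : pred (game_conf k) :=
  if k is k'.+1 then round_bad (@game_bad k') else id.

(** Every leaf counts as a disagreement, so the mass starts at 1 and is halved at each round. *)
Fixpoint game_diff (k : nat) : pred (game_conf k) :=
  if k is k'.+1 then round_diff (@game_diff k') (@game_bad k') else predT.

Variable q : R.
Hypothesis q01 : 0 <= q <= 1.

Lemma prob_weight_game k : prob_weight (@game_weight q k).
Proof.
elim: k => [|k IH]; last exact: prob_weight_round.
have /andP[q0 q1] := q01; split=> [[]|] //=; first by rewrite subr_ge0.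
by rewrite /mass big_bool/= addrC subrK.
Qed.

Hypothesis q_bad : q <= bad_bound.

Lemma mass_game_bad k : mass (@game_weight q k) (@game_bad k) <= bad_bound.
Proof.
elim: k => [|k IH]; first by rewrite /mass big_mkcond big_bool/= addr0.
apply: le_trans (mass_round_bad _ (prob_weight_game k) _) (bad_bound_step _).
by rewrite IH mass_ge0//; exact: prob_weight_game.
Qed.

Lemma mass_game_diff k : mass (@game_weight q k) (@game_diff k) <= 2 ^- k.
Proof.
elim: k => [|k IH].
  by rewrite expr0 invr1; have [_ <-] := prob_weight_game 0.
apply: le_trans (mass_round_diff _ (prob_weight_game k) _ _) _.
apply: le_trans (diff_bound_step _ _) _.
- exact/mass_ge0/prob_weight_game.
- by rewrite mass_game_bad mass_ge0//; exact: prob_weight_game.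
by rewrite exprS invfM ler_pM2l// invr_gt0.
Qed.

End Iteration.
End FiniteMass.

(** * Pathwise comparison with a finite configuration *)

Section Paths.
Variables (R : realType) (d : nat).
Hypothesis d_gt0 : (0 < d)%N.

Fixpoint config (s : edge d -> bool) (b : vertex d -> bool) (k : nat)
    (v : vertex d) : game_conf d k :=
  if k is k'.+1 then
    [ffun i => (s (v, i),
      [ffun j => (s (i :: v, j), config s b k' (j :: i :: v))])]
  else b v.

Definition round_value (x : edge d -> R) (U : vertex d -> R) (v : vertex d) :
    R :=
  fmax (fun i : 'I_d => x (v, i) +
    fmin (fun j : 'I_d => x (i :: v, j) + U (j :: i :: v))).

Variables (x : edge d -> R) (b : vertex d -> bool).
Hypothesis x_pm1 : forall e, x e = 1 \/ x e = -1.
Let s (e : edge d) : bool := x e == 1.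

Lemma stepP e : if s e then x e = 1 else x e = -1.
Proof.
by rewrite /s; case: eqP => // x1; case: (x_pm1 e).
Qed.

(** Common frame for the two processes to be compared: the game stopped with value 0 after k rounds,
    and the process V, for which [U] does not depend on k. The same [b] covers the nonzero leaves of
    both. *)
Definition value_family (U : nat -> vertex d -> R) : Prop :=
  (forall k v, ~~ odd (size v) -> U k.+1 v = round_value x (U k) v) /\
  (forall v, U 0 v != 0 -> b v).

(** If the round is not bad, a step that is not stuck makes the maximum at least 0, and an odd step
    that is not loose under each i makes it at most 0. *)
Lemma config_bad (U : nat -> vertex d -> R) k v : value_family U ->
  ~~ odd (size v) -> U k v != 0 -> game_bad (config s b k v).
Proof.
move=> [Urec U0]; elim: k v => [|k IH] v ev; first exact: U0.
apply: contraR; rewrite Urec// /round_value /= /round_bad.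
rewrite negb_or negb_forall negb_exists.
move=> /andP[/existsP[i0 +] /forallP loos].
rewrite /stuck !ffunE/= negb_or negbK negb_exists => /andP[si0 /forallP nb].
have U00 j : U k (j :: i0 :: v) = 0.
  apply/eqP; move: (nb j); rewrite !ffunE /=; apply: contraR; apply: IH.
  by rewrite /= negbK.
set f := fun i : 'I_d => x (v, i) + _.
have [[i fi] fge] := fmaxP f d_gt0.
rewrite -/f; apply/eqP/le_anti/andP; split.
  rewrite fi /f.
  move: (loos i); rewrite negb_forall => /existsP[j].
  rewrite /loose !ffunE/= negb_or.
  move=> /andP[sj nbj].
  have Uj : U k (j :: i :: v) = 0.
    apply/eqP; move: nbj; apply: contraR; apply: IH.
    by rewrite /= negbK.
  have := (fminP (fun j : 'I_d => x (i :: v, j) + U k (j :: i :: v)) d_gt0).2 j.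
  have := stepP (i :: v, j); rewrite (negbTE sj) Uj => ->.
  by case: (x_pm1 (v, i)) => ->; lra.
apply: le_trans (fge i0); rewrite /f.
have [[j ->] _] := fminP
  (fun j : 'I_d => x (i0 :: v, j) + U k (j :: i0 :: v)) d_gt0.
have := stepP (v, i0); rewrite si0 => ->; rewrite U00.
by case: (x_pm1 (i0 :: v, j)) => ->; lra.
Qed.

(** The pivotal grandchild follows the best even step i for the larger value [U'], then the best
    reply j for the smaller value [U]. *)
Lemma round_value_lt (U U' : nat -> vertex d -> R) k v :
  value_family U -> value_family U' -> ~~ odd (size v) ->
  U k.+1 v < U' k.+1 v ->
  exists i j, U k (j :: i :: v) < U' k (j :: i :: v) /\
    let c := config s b k.+1 v in
    ([forall i', (i' != i) ==> stuck (@game_bad d k) (c i')] ||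
     [forall j', (j' != j) ==> loose (@game_bad d k) ((c i).2 j')]).
Proof.
move=> HU HU' ev; rewrite (HU.1)// (HU'.1)// /round_value.
set f := fun i : 'I_d => x (v, i) + _; set f' := fun i : 'I_d => x (v, i) + _.
have [_ fge] := fmaxP f d_gt0; have [[i f'i] _] := fmaxP f' d_gt0.
set m := fmax f in fge *; rewrite f'i => mlt.
have [[j mi] _] := fminP
  (fun j : 'I_d => x (i :: v, j) + U k (j :: i :: v)) d_gt0.
have [_ m'i] := fminP
  (fun j : 'I_d => x (i :: v, j) + U' k (j :: i :: v)) d_gt0.
exists i, j; split.
  by have := fge i; have := m'i j; move: mlt; rewrite /f /f' mi; lra.
(* The sign of the smaller value decides. If it is negative, no even step can guarantee 0, so they
   are stuck. Otherwise the larger value is positive, and an odd step under i that is not loose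
   would cap it at 0. *)
apply/orP; case: (ltP m 0) => m0; [left|right];
  apply/forallP => i'; apply/implyP => _.
  rewrite /stuck /= !ffunE /=; apply/negPn/negP.
  rewrite negb_or negbK negb_exists => /andP[si' /forallP nb].
  have := fge i'; rewrite /f.
  have [[j' ->] _] := fminP
    (fun j : 'I_d => x (i' :: v, j) + U k (j :: i' :: v)) d_gt0.
  have -> : U k (j' :: i' :: v) = 0.
    apply/eqP; move: (nb j'); rewrite !ffunE /=.
    apply: contraR; apply: config_bad => //.
    by rewrite /= negbK.
  have := stepP (v, i'); rewrite si' => ->.
  by case: (x_pm1 (i' :: v, j')) => ->; lra.
rewrite /loose /= !ffunE /=; apply/negPn/negP; rewrite negb_or => /andP[si' nb].
have := m'i i'.
have -> : U' k (i' :: i :: v) = 0.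
  apply/eqP; move: nb; apply: contraR; apply: config_bad => //.
  by rewrite /= negbK.
have := stepP (i :: v, i'); rewrite (negbTE si') => ->.
by move: mlt; rewrite /f'; case: (x_pm1 (v, i)) => ->; lra.
Qed.

Lemma config_diff (U U' : nat -> vertex d -> R) k v :
  value_family U -> value_family U' ->
  ~~ odd (size v) -> U k v != U' k v -> game_diff (config s b k v).
Proof.
move=> HU HU'; elim: k v => [|k IH] v ev neq //.
suff [i [j [neqij h]]] : exists i j, U k (j :: i :: v) != U' k (j :: i :: v) /\
    let c := config s b k.+1 v in
    ([forall i', (i' != i) ==> stuck (@game_bad d k) (c i')] ||
     [forall j', (j' != j) ==> loose (@game_bad d k) ((c i).2 j')]).
  apply/existsP; exists i; apply/existsP; exists j.
  rewrite h andbT /= !ffunE /=.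
  by apply: IH => //=; rewrite negbK.
move: neq; rewrite neq_lt => /orP[] /round_value_lt.
  move=> /(_ HU HU' ev)[i [j [lt_ij h]]]; exists i, j; split=> //.
  by rewrite lt_eqF.
move=> /(_ HU' HU ev)[i [j [lt_ij h]]]; exists i, j; split=> //.
by rewrite gt_eqF.
Qed.

End Paths.

(** * Law of the configuration *)

Section Levels.
Variable d : nat.

Fixpoint level (m : nat) : seq (vertex d) :=
  if m is m'.+1 then [seq i :: v | v <- level m', i <- enum 'I_d]
  else [:: [::]].

Fixpoint edges_above (m : nat) : seq (edge d) :=
  if m is m'.+1 then
    [seq (v, i) | v <- level m', i <- enum 'I_d] ++ edges_above m'
  else [::].

Lemma size_level m v : v \in level m -> size v = m.
Proof.
elim: m v => [|m IH] v /=; first by rewrite inE => /eqP ->.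
by move=> /allpairsP[[w i] /= [/IH wm _ ->]] /=; rewrite wm.
Qed.

Lemma uniq_level m : uniq (level m).
Proof.
elim: m => [//|m IH] /=; apply: allpairs_uniq => //; first exact: enum_uniq.
by move=> [v i] [w j] _ _ /= [-> ->].
Qed.

Lemma size_edges_above m e : e \in edges_above m -> (size e.1 < m)%N.
Proof.
elim: m => [//|m IH] /=; rewrite mem_cat => /orP[|/IH/ltnW //].
by move=> /allpairsP[[w i] /= [/size_level wm _ ->]] /=; rewrite wm.
Qed.

Lemma uniq_edges_above m : uniq (edges_above m).
Proof.
elim: m => [//|m IH] /=; rewrite cat_uniq IH andbT; apply/andP; split.
  apply: allpairs_uniq; [exact: uniq_level|exact: enum_uniq|].
  by move=> [v i] [w j] _ _ /= [-> ->].
apply/hasPn => e /size_edges_above em; apply/negP.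
move=> /allpairsP[[w i] /= [/size_level wm _ ee]].
by rewrite ee/= wm ltnn in em.
Qed.

Lemma all_allpairs (S1 S2 S3 : Type) (f : S1 -> S2 -> S3) (p : pred S3) r t :
  all p [seq f a c | a <- r, c <- t] =
  all (fun a => all (fun c => p (f a c)) t) r.
Proof.
by elim: r => [//|a r IH] /=; rewrite all_cat IH all_map.
Qed.

Lemma ffun_eq_all (T : eqType) (f g : {ffun 'I_d -> T}) :
  (f == g) = all (fun i => f i == g i) (enum 'I_d).
Proof.
apply/eqP/allP => [-> //|h]; apply/ffunP => i; apply/eqP/h.
by rewrite mem_enum.
Qed.

End Levels.

Section Law.
Variables (R : realType) (d : nat) (dT : measure_display).
Variables (T : measurableType dT) (P : probability T R).
Variables (s : T -> edge d -> bool) (b : T -> vertex d -> bool).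
Variables (n : nat) (q : R).

(** For m = n, k = 0 an atom prescribes all the leaf bits and signs; for m = 0, k = n it prescribes
    the configuration at the root. [atom_law] goes from the former to the latter. *)
Definition atom (m k : nat) (c : vertex d -> game_conf d k)
    (y : edge d -> bool) : set T :=
  [set om | all (fun v => config (s om) (b om) k v == c v) (level d m.*2) &&
            all (fun e => s om e == y e) (edges_above d m.*2)].

Definition atom_weight (m k : nat) (c : vertex d -> game_conf d k) : R :=
  (\prod_(v <- level d m.*2) game_weight q (c v)) *
  \prod_(e <- edges_above d m.*2) 2^-1.

Hypothesis leaf_law : forall (c : vertex d -> bool) y,
  P (atom n (k := 0) c y) = (atom_weight n (k := 0) c)%:E.

(* One round at a time, the configurations at level 2m + 2 and the cookies
   between the two levels are regrouped into configurations at level 2m. *)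
Lemma atom_law k m (c : vertex d -> game_conf d k) y : (m + k = n)%N ->
  P (atom m c y) = (atom_weight m c)%:E.
Proof.
elim: k m c y => [|k IH] m c y.
  by rewrite addn0 => mn; subst m; exact: leaf_law.
rewrite -addSnnS => mkn.
(* [c'] and [y'] unfold [c] into the subconfigurations two levels lower and the signs on the two
   levels of edges in between; on edges higher up [y'] is [y]. The remaining branches are
   fillers. *)
pose c' (w : vertex d) : game_conf d k :=
  if w is j :: i :: v then ((c v i).2 j).2
  else config (fun=> false) (fun=> false) k w.
pose y' (e : edge d) : bool :=
  if size e.1 == m.*2 then (c e.1 e.2).1 else
  if size e.1 == m.*2.+1 then
    (if e.1 is i :: v then ((c v i).2 e.2).1 else false)
  else y e.
have -> : atom m c y = atom m.+1 c' y'.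
  apply: eq_set => om; congr is_true.
  rewrite doubleS /= !all_cat !all_allpairs.
  have -> : all (fun e => s om e == y' e) (edges_above d m.*2) =
            all (fun e => s om e == y e) (edges_above d m.*2).
    apply: eq_in_all => e /size_edges_above em; rewrite /y'.
    by rewrite ltn_eqF// ltn_eqF// ltnW.
  rewrite !andbA; congr (_ && _); rewrite -!all_predI.
  apply: eq_in_all => v /size_level vm /=.
  rewrite ffun_eq_all -!all_predI; apply: eq_in_all => i _ /=.
  rewrite ffunE (surjective_pairing (c v i)) xpair_eqE /= ffun_eq_all.
  rewrite /y' /= vm eqxx eqn_leq ltnn/= eqxx.
  rewrite [RHS]andbC; congr (_ && _); rewrite -!all_predI.
  apply: eq_in_all => j _ /=.
  by rewrite ffunE (surjective_pairing ((c v i).2 j)) xpair_eqE /= andbC.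
rewrite IH//; congr EFin; rewrite /atom_weight doubleS /=.
rewrite !big_cat/= !big_allpairs_dep/=.
rewrite !mulrA; congr (_ * _); rewrite -!big_split/=.
apply: eq_bigr => v _; rewrite /round_weight /power_weight /coin_weight.
rewrite !big_enum /= -!big_split/=; apply: eq_bigr => i _.
rewrite !big_enum /= mulrC; congr (_ * _).
by rewrite -!big_split/=; apply: eq_bigr => j _; rewrite mulrC.
Qed.

Lemma config_law (c : game_conf d n) :
  P [set om | config (s om) (b om) n [::] == c] = (game_weight q c)%:E.
Proof.
rewrite (_ : [set om | _] = atom 0 (fun=> c) (fun=> false)).
  by rewrite atom_law// /atom_weight/= big_seq1 big_nil mulr1.
by apply/seteqP; split=> om; rewrite /atom/= !andbT.
Qed.

End Law.

(** * Events determined by a finite configuration *)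

Section FiniteMeasurability.
Variables (dT : measure_display) (T : measurableType dT).

Lemma measurable_all (S : Type) (p : S -> T -> bool) (s : seq S) :
  (forall x, measurable [set om | p x om]) ->
  measurable [set om | all (p^~ om) s].
Proof.
move=> mp; elim: s => [|a s IH].
  by rewrite (_ : [set _ | _] = setT)//; apply/seteqP; split.
rewrite (_ : [set _ | _] = [set om | p a om] `&` [set om | all (p^~ om) s]).
  exact: measurableI.
by apply/seteqP; split => om /= => [/andP[]|[-> ->]].
Qed.

Lemma measurable_config d (s : T -> edge d -> bool)
    (b : T -> vertex d -> bool) k v c :
  (forall e y, measurable [set om | s om e == y]) ->
  (forall w y, measurable [set om | b om w == y]) ->
  measurable [set om | config (s om) (b om) k v == c].
Proof.
move=> ms mb; elim: k v c => [|k IH] v c /=; first exact: mb.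
under eq_set do rewrite ffun_eq_all.
apply: measurable_all => i.
under eq_set do rewrite ffunE (surjective_pairing (c i)) xpair_eqE ffun_eq_all.
rewrite (_ : [set _ | _] = [set om | s om (v, i) == (c i).1] `&`
  [set om | all (fun j => [ffun j => (s om (i :: v, j),
     config (s om) (b om) k [:: j, i & v])] j == (c i).2 j) (enum 'I_d)]);
  last first.
  by apply/seteqP; split => om /= => [/andP[]|[-> ->]].
apply: measurableI; first exact: ms.
apply: measurable_all => j.
under eq_set do rewrite ffunE (surjective_pairing ((c i).2 j)) xpair_eqE.
rewrite (_ : [set _ | _] = [set om | s om (i :: v, j) == ((c i).2 j).1] `&`
  [set om | config (s om) (b om) k [:: j, i & v] == ((c i).2 j).2]); last first.
  by apply/seteqP; split => om /= => [/andP[]|[-> ->]].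
by apply: measurableI; [exact: ms|exact: IH].
Qed.

Lemma measurable_finite_pred (S : finType) (h : T -> S) (A : pred S) :
  (forall c, measurable [set om | h om == c]) -> measurable [set om | A (h om)].
Proof.
move=> mh.
rewrite (_ : [set _ | _] = \bigcup_(c in [set c | A c]) [set om | h om == c]).
  by apply: fin_bigcup_measurable.
apply/seteqP; split => [om /= Ah|om /= [c /= Ac /eqP ->]//].
by exists (h om) => /=.
Qed.

Lemma finite_pred_mass (R : realType) (P : probability T R) (S : finType)
    (h : T -> S) (w : S -> R) (A : pred S) :
  (forall c, measurable [set om | h om == c]) ->
  (forall c, P [set om | h om == c] = (w c)%:E) ->
  (P [set om | A (h om)] <= (mass w A)%:E)%E.
Proof.
move=> mh Ph.
have H (r : seq S) : (P [set om | h om \in r] <= (\sum_(c <- r) w c)%:E)%E.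
  elim: r => [|a r IH].
    rewrite big_nil (_ : [set _ | _] = set0) ?measure0//.
    by apply/seteqP; split.
  rewrite big_cons EFinD -Ph (_ : [set _ | _] =
    [set om | h om == a] `|` [set om | h om \in r]); last first.
    apply/seteqP; split => om /=; rewrite inE; first by move/orP.
    by move=> [->//|->]; rewrite orbT.
  apply: le_trans (measureU2 _ _ _) _ => //.
    exact: (measurable_finite_pred (mem r)).
  exact: leeD2l.
rewrite (_ : [set om | A (h om)] = [set om | h om \in enum A]).
  by apply: le_trans (H (enum A)) _; rewrite big_enum.
by apply: eq_set => om; rewrite mem_enum.
Qed.

End FiniteMeasurability.

Lemma rv_preimage_measurable (R : realType) (dT : measure_display)
    (T : measurableType dT) (P : probability T R) (Z : {RV P >-> R})
    (B : set R) : measurable B -> measurable (Z @^-1` B).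
Proof.
by move=> mB; rewrite -[X in measurable X]setTI; exact: measurable_funP.
Qed.

Lemma rv_eqb_measurable (R : realType) (dT : measure_display)
    (T : measurableType dT) (P : probability T R) (Z : {RV P >-> R})
    (y : R) (c : bool) : measurable [set om | (Z om == y) == c].
Proof.
have m1 : measurable (Z @^-1` [set y]) by exact: rv_preimage_measurable.
have -> : [set om | (Z om == y) == c] =
    if c then Z @^-1` [set y] else ~` (Z @^-1` [set y]).
  by case: c; apply/seteqP; split => om /=; case: (Z om =P y).
by case: c => //; exact: measurableC.
Qed.

Lemma rv_neq_measurable (R : realType) (dT : measure_display)
    (T : measurableType dT) (P : probability T R) (Z : {RV P >-> R})
    (y : R) : measurable [set om | Z om != y].
Proof.
rewrite (_ : [set _ | _] = [set om | (Z om == y) == false]).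
  exact: rv_eqb_measurable.
by apply: eq_set => om; rewrite eqbF_neg.
Qed.

(** * Joint law of the cookies and the leaf events *)

Section Cookies.
Variables (R : realType) (d : nat) (dT : measure_display).
Variables (T : measurableType dT) (P : probability T R).
Variables (X : edge d -> {RV P >-> R}).
Hypothesis hX : iid_cookies X.

Lemma cookies_pm1 : {ae P, forall om, forall e, X e om = 1 \/ X e om = -1}.
Proof.
have one e : {ae P, forall om, X e om = 1 \/ X e om = -1}.
  exists (~` (X e @^-1` [set 1] `|` X e @^-1` [set -1])).
  have m1 (y : R) : measurable (X e @^-1` [set y]).
    exact: rv_preimage_measurable.
  have mU : measurable (X e @^-1` [set 1] `|` X e @^-1` [set -1]).
    exact: measurableU.
  split; [exact: measurableC| |].
    rewrite probability_setC// measureU//.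
      transitivity (1 - ((2^-1 : R)%:E + (2^-1 : R)%:E))%E.
        congr (_ - (_ + _))%E; first exact: (cookies_plus hX).
        exact: (cookies_minus hX).
      by congr EFin; field.
    apply/seteqP; split => // om [/= -> h].
    by have : (1 : R) = -1 by []; lra.
  by move=> om /= h [] h'; apply: h; [left|right].
(* The edges are countable: number them, with a trivial condition at the numbers that code no
   edge. *)
pose Q (k : nat) om := if @choice.unpickle (edge d) k is Some e then
  X e om = 1 \/ X e om = -1 else True.
have /ae_foralln : forall k, {ae P, forall om, Q k om}.
  move=> k; rewrite /Q; case: (choice.unpickle k) => [e|]; first exact: one.
  exact: aeW.
apply: filterS => om H e.
by have := H (choice.pickle e); rewrite /Q choice.pickleK.
Qed.

Lemma family_events_bigcap (I : choiceType) (D : set I) (Z : I -> T -> R)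
    (J : {fset I}) (B : I -> set R) : [set` J] `<=` D ->
  (forall i, measurable (B i)) ->
  <<s family_events D Z >> (\bigcap_(i in [set` J]) Z i @^-1` B i).
Proof.
move=> JD mB.
apply: (@fin_bigcap_measurable _ (g_sigma_algebraType (family_events D Z))).
  exact: finite_fset.
move=> i Ji; apply: sub_sigma_algebra; exists i; first exact: JD.
by exists (B i); [exact: mB|rewrite setTI].
Qed.

Lemma prod_fset_seq (I : choiceType) (r : seq I) (F : I -> \bar R) : uniq r ->
  (\prod_(i <- [fset i in r]%fset) F i = \prod_(i <- r) F i)%E.
Proof.
move=> ur; apply: perm_big; apply: uniq_perm => //.
by move=> i; rewrite inE.
Qed.

Variables (n : nat) (V : vertex d -> {RV P >-> R}) (q : R).
Hypothesis V_indep : independent_family [set v : vertex d | size v = n.*2] V.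
Hypothesis VX_indep : independent_of [set v : vertex d | size v = n.*2] V
  [set e : edge d | (size e.1 < n.*2)%N] X.
Hypothesis V_neq0 : forall v : vertex d, size v = n.*2 ->
  P [set om | V v om != 0] = q%:E.

Let s (om : T) (e : edge d) : bool := X e om == 1.
Let b (om : T) (v : vertex d) : bool := V v om != 0.

(** An atom is a cylinder event of the leaves intersected with one of the cookies above them. The
    independence of the two families, then the independence inside each, gives a factor q or 1 - q
    per leaf and 1/2 per cookie. *)
Lemma leaf_law (c : vertex d -> bool) y :
  P (atom s b n (k := 0) c y) = (atom_weight q n (k := 0) c)%:E.
Proof.
pose BV v : set R := if c v then [set~ 0] else [set 0].
pose BX e : set R := if y e then [set 1] else [set~ 1].
have mBV v : measurable (BV v).
  by rewrite /BV; case: ifP => _ //; exact: measurableC.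
have mBX e : measurable (BX e).
  by rewrite /BX; case: ifP => _ //; exact: measurableC.
have JV : [set` [fset v in level d n.*2]%fset] `<=`
    [set v : vertex d | size v = n.*2].
  by move=> v /=; rewrite inE => /size_level.
have JX : [set` [fset e in edges_above d n.*2]%fset] `<=`
    [set e : edge d | (size e.1 < n.*2)%N].
  by move=> v /=; rewrite inE => /size_edges_above.
have -> : atom s b n (k := 0) c y =
  (\bigcap_(v in [set` [fset v in level d n.*2]%fset]) V v @^-1` BV v) `&`
  (\bigcap_(e in [set` [fset e in edges_above d n.*2]%fset]) X e @^-1` BX e).
  apply/seteqP; split => om /=.
    move=> /andP[/allP hV /allP hE]; split.
      move=> v /=; rewrite inE => /hV; rewrite /= /b /BV => /eqP <-.
      by case: eqP.
    move=> e /=; rewrite inE => /hE; rewrite /= /s /BX => /eqP <-.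
    by case: eqP.
  move=> [hV hE]; apply/andP; split; apply/allP.
    move=> v vl; have /= := hV v; rewrite inE => /(_ vl).
    by rewrite /BV /b; case: (V v om =P 0) => [->|V0]; case: (c v) => //=.
  move=> e el; have /= := hE e; rewrite inE => /(_ el).
  by rewrite /BX /s; case: (X e om =P 1) => [->|X1]; case: (y e) => //=.
rewrite (VX_indep (family_events_bigcap (Z := V) JV mBV)
  (family_events_bigcap (Z := X) JX mBX)).
rewrite (V_indep JV mBV) (cookies_independent hX _ mBX); last exact: subsetT.
rewrite prod_fset_seq ?uniq_level// prod_fset_seq ?uniq_edges_above//.
rewrite /atom_weight EFinM -!prodEFin; congr (_ * _)%E.
  apply: eq_big_seq => v /size_level vl; rewrite /BV /=.
  have Vv : P (V v @^-1` [set~ 0]) = q%:E.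
    rewrite -(V_neq0 vl); congr (P _); apply/seteqP; split => om /=.
      by move/eqP.
    by move=> /eqP.
  case: (c v) => //; rewrite EFinB -Vv -probability_setC.
    by congr (P _); rewrite preimage_setC setCK.
  by rewrite -preimage_setC; apply: measurableC; exact: rv_preimage_measurable.
apply: eq_bigr => e _; rewrite /BX; case: (y e); first exact: cookies_plus.
rewrite -preimage_setC probability_setC; last exact: rv_preimage_measurable.
transitivity (1 - (2^-1 : R)%:E)%E.
  by congr (_ - _)%E; exact: cookies_plus.
by congr EFin; field.
Qed.

Lemma b_measurable v y : measurable [set om | b om v == y].
Proof.
rewrite (_ : [set _ | _] = [set om | (V v om == 0) == ~~ y]).
  exact: rv_eqb_measurable.
by apply: eq_set => om; rewrite /b; case: (V v om == 0); case: y.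
Qed.

Definition config_event (A : pred (game_conf d n)) : set T :=
  [set om | A (config (s om) (b om) n [::])].

Lemma config_event_measurable A : measurable (config_event A).
Proof.
apply: (measurable_finite_pred
  (h := fun om => config (s om) (b om) n [::])) => c.
apply: measurable_config; last exact: b_measurable.
by move=> e y; exact: rv_eqb_measurable.
Qed.

Lemma config_event_le A :
  (P (config_event A) <= (mass (game_weight q (k := n)) A)%:E)%E.
Proof.
apply: (finite_pred_mass (h := fun om => config (s om) (b om) n [::])) => c.
  apply: measurable_config; last exact: b_measurable.
  by move=> e y; exact: rv_eqb_measurable.
exact: (config_law leaf_law).
Qed.

End Cookies.

(** * The value of the game as a random variable *)

Section GameMeasurability.
Variables (R : realType) (d : nat).
Variables (dT : measure_display) (T : measurableType dT).

Lemma measurable_head_codom (f : T -> 'I_d -> R) :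
  (forall i, measurable_fun [set: T] (f ^~ i)) ->
  measurable_fun [set: T] (fun om => head 0 (codom (f om))).
Proof.
move=> mf; under eq_fun do rewrite codomE.
case: (enum 'I_d) => [|i r] /=; first exact: measurable_cst.
exact: mf.
Qed.

Lemma measurable_fmax (f : T -> 'I_d -> R) :
  (forall i, measurable_fun [set: T] (f ^~ i)) ->
  measurable_fun [set: T] (fun om => fmax (f om)).
Proof.
move=> mf; rewrite /fmax; elim: (index_enum _) => [|i r IH].
  by under eq_fun do rewrite big_nil; exact: measurable_head_codom.
under eq_fun do rewrite big_cons.
exact: measurable_maxr.
Qed.

Lemma measurable_fmin (f : T -> 'I_d -> R) :
  (forall i, measurable_fun [set: T] (f ^~ i)) ->
  measurable_fun [set: T] (fun om => fmin (f om)).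
Proof.
move=> mf; rewrite /fmin; elim: (index_enum _) => [|i r IH].
  by under eq_fun do rewrite big_nil; exact: measurable_head_codom.
under eq_fun do rewrite big_cons.
exact: measurable_minr.
Qed.

Variable x : T -> edge d -> R.
Hypothesis mx : forall e, measurable_fun [set: T] (x ^~ e).

Lemma measurable_stopped_value k v :
  measurable_fun [set: T] (fun om => stopped_value (x om) k v).
Proof.
elim: k v => [|k IH] v /=; first exact: measurable_cst.
by case: odd; [apply: measurable_fmin|apply: measurable_fmax] => i;
  apply: measurable_funD.
Qed.

Lemma measurable_game_value n v :
  measurable_fun [set: T] (fun om => game_value (x om) n v).
Proof. exact: measurable_stopped_value. Qed.

Lemma measurable_fine (h : T -> \bar R) : measurable_fun [set: T] h ->
  measurable_fun [set: T] (fun om => fine (h om)).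
Proof. by move=> mh; apply: measurableT_comp => //; exact: fine_measurable. Qed.

Lemma measurable_game_limsup : measurable_fun [set: T]
  (fun om => limn_esup (fun n => (game_value (x om) n [::])%:E)).
Proof.
apply: measurable_fun_limn_esup => n; apply/measurable_EFinP.
exact: measurable_game_value.
Qed.

Lemma measurable_game_liminf : measurable_fun [set: T]
  (fun om => limn_einf (fun n => (game_value (x om) n [::])%:E)).
Proof.
rewrite /limn_einf; apply: measurableT_comp => //.
apply: measurable_fun_limn_esup => n; apply: measurableT_comp => //.
by apply/measurable_EFinP; exact: measurable_game_value.
Qed.

End GameMeasurability.

(** Expresses convergence by quantities that are measurable in the cookies. Conversely, [u] is
    squeezed between its tail infima and suprema. *)
Lemma cvgn_einf_esup (R : realType) (u : R^nat) :
  cvgn u <-> (let l := limn_einf (EFin \o u) in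
    l \is a fin_num /\ limn_esup (EFin \o u) = l).
Proof.
split=> [/cvg_ex[l ul]|/= [l_fin eq_l]].
  have : (EFin \o u) @ \oo --> l%:E by apply: cvg_EFin; [exact: nearW|].
  by move=> /cvg_limn_einf_sup[-> ->].
have : (EFin \o u) @ \oo --> limn_einf (EFin \o u).
  apply: (@squeeze_cvge _ _ _ _ (einfs (EFin \o u)) _ (esups (EFin \o u))).
  - apply: nearW => n; apply/andP; split.
      by apply: ereal_inf_lbound; exists n => /=.
    by apply: ereal_sup_ubound; exists n => /=.
  - rewrite limn_einf_lim; exact: is_cvg_einfs.
  - rewrite -eq_l limn_esup_lim; exact: is_cvg_esups.
rewrite -(fineK l_fin) => /fine_cvg ul; apply/cvg_ex; eexists; exact: ul.
Qed.

Section Values.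
Variables (R : realType) (d : nat) (x : edge d -> R).

Lemma game_value_family (b : vertex d -> bool) :
  value_family x b (fun k v => stopped_value x k.*2 v).
Proof.
split=> [k v ev|v]; last by rewrite /= eqxx.
by rewrite doubleS /= (negbTE ev) /round_value.
Qed.

Lemma game_valueE n : game_value x n [::] = stopped_value x n.*2 [::].
Proof. by rewrite /game_value subn0. Qed.

End Values.

Lemma measurable_game_limit (R : realType) d dT (T : measurableType dT)
    (x : T -> edge d -> R) :
  (forall e, measurable_fun [set: T] (x ^~ e)) ->
  measurable_fun [set: T] (fun om => game_limit (x om)).
Proof.
move=> mx.
pose S om := limn_esup (fun n => (game_value (x om) n [::])%:E).
pose I om := limn_einf (fun n => (game_value (x om) n [::])%:E).
have mS : measurable_fun [set: T] S by exact: measurable_game_limsup.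
have mI : measurable_fun [set: T] I by exact: measurable_game_liminf.
pose C om : bool := [&& I om \is a fin_num, S om \is a fin_num &
  fine (S om) == fine (I om)].
have CP om : C om <-> cvgn (fun n => game_value (x om) n [::]).
  rewrite cvgn_einf_esup /C /= -/(S om) -/(I om); split.
    move=> /and3P[If Sf /eqP eqSI]; split => //.
    by rewrite -(fineK Sf) -(fineK If) eqSI.
  by move=> [If SI]; rewrite /I /S /= in If SI *; rewrite SI If eqxx.
(* Outside the measurable event [C] of convergence, [limn] takes its default value 0. *)
rewrite (_ : (fun om => _) = (fun om => if C om then fine (S om) else 0)).
  apply: measurable_fun_ifT => //; last first.
  - exact: measurable_fine.
  - apply: (measurable_fun_bool true); rewrite setTI.
    rewrite (_ : _ @^-1` _ = (setT `&` [set om | I om \is a fin_num]) `&`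
       (setT `&` [set om | S om \is a fin_num]) `&`
       (setT `&` (fun om => fine (S om) == fine (I om)) @^-1` [set true])).
      apply: measurableI; first apply: measurableI.
      + exact: emeasurable_fin_num.
      + exact: emeasurable_fin_num.
      + by apply: measurable_fun_eqr => //; exact: measurable_fine.
    apply/seteqP; split => om /=; rewrite /C; first by move=> /and3P[].
    by move=> [[[_ ->] [_ ->]] [_ ->]].
apply/funext => om; case: ifPn => [/CP cv|/negP nC].
  rewrite /S; move: cv => /cvg_ex[l ul]; rewrite /game_limit (cvg_lim _ ul)//.
  have eul : (EFin \o (fun n => game_value (x om) n [::])) @ \oo --> l%:E.
    by apply: cvg_EFin; [exact: nearW|].
  by have [_ ->] := cvg_limn_einf_sup eul.
by rewrite /game_limit dvgP// => /CP.
Qed.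

(* Where the sequence diverges, limn is the default value 0. *)
Lemma game_limit_neq0 (R : realType) d (x : edge d -> R) : game_limit x != 0 ->
  \forall n \near \oo, game_value x n [::] != 0.
Proof.
move=> l0; have /cvg_ex[l ul] : cvgn (fun n => game_value x n [::]).
  by apply: contrapT => /dvgP h; move: l0; rewrite /game_limit h eqxx.
move: l0; rewrite /game_limit (cvg_lim _ ul)// => l0.
exact: (cvgr_neq0 l ul).
Qed.

(** * The zero boundary condition as a family of constant leaves *)

Section ConstantLeaves.
Variables (R : realType) (I J : choiceType) (dT : measure_display).
Variables (T : measurableType dT) (P : probability T R).

Lemma independent_family_cst0 (D : set I) :
  independent_family (P := P) D (fun=> cst 0).
Proof.
move=> K B _ mB; have [B0|] := pselect (forall i, i \in K -> B i 0).
  rewrite (_ : \bigcap_(i in _) _ = setT); last first.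
    by apply/seteqP; split => // om _ i /= iK; exact: B0.
  rewrite big_seq big1 ?probability_setT// => i iK.
  rewrite (_ : _ @^-1` _ = setT) ?probability_setT//.
  by apply/seteqP; split => // om _ /=; exact: B0.
move=> /existsNP[i /not_implyP[iK nB]].
rewrite (_ : \bigcap_(i in _) _ = set0); last first.
  by apply/seteqP; split => // om /(_ i iK).
rewrite measure0 (big_rem i)//= (_ : _ @^-1` _ = set0) ?measure0 ?mul0e//.
by apply/seteqP; split.
Qed.

(** Constants generate the trivial sigma-algebra, made of the empty and the full event. *)
Lemma independent_of_cst0 (D : set I) (E : set J) (Y : J -> {RV P >-> R}) :
  independent_of D (fun=> cst 0) E Y.
Proof.
move=> A B HA HB.
have {HA} [->|->] : A = set0 \/ A = setT.
  have : <<s family_events D (fun=> (cst 0 : {RV P >-> R}) : T -> R) >> `<=`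
      [set A | A = set0 \/ A = setT].
    apply: smallest_sub => /=.
      split => /=; first by left.
    - by move=> C [->|->]; rewrite ?setD0 ?setDv; [right|left].
    - move=> F HF; have [[i Fi]|nF] := pselect (exists i, F i = setT).
        by right; apply/seteqP; split => // om _; exists i => //; rewrite Fi.
      left; apply/seteqP; split => // om [i _ Fi].
      have [Fi0|FiT] := HF i; first by rewrite Fi0 in Fi.
      by apply: nF; exists i.
    move=> C [i _ [B' _ <-]]; rewrite setTI /=.
    have [B0|nB0] := pselect (B' 0); [right|left]; by apply/seteqP; split.
  exact.
- by rewrite set0I measure0 mul0e.
- by rewrite setTI probability_setT mul1e.
Qed.

End ConstantLeaves.

(** * Endogeny *)

Section CdfNeq0.
Variables (R : realType).

(** These sets increase to the complement of {0}; half-open intervals are removed so that the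
    probabilities are differences of values of the CDF. *)
Let off0 (k : nat) : set R := ~` `]-k.+1%:R^-1, 0].

Let off0_measurable k : measurable (off0 k).
Proof. exact: measurableC. Qed.

Let off0E (dT : measure_display) (T : measurableType dT) (Z : T -> R) :
  [set om | Z om != 0] = \bigcup_k Z @^-1` off0 k.
Proof.
apply/seteqP; split => [om /= Z0|om [k _] /=]; last first.
  rewrite /off0 /= in_itv /=; apply: contra_notN => /eqP ->.
  by rewrite lexx andbT oppr_lt0 invr_gt0 ltr0n.
move: Z0; rewrite neq_lt => /orP[Zlt|Zgt]; last first.
  by exists 0%N => //; rewrite /off0 /= in_itv/= => /andP[_]; rewrite leNgt Zgt.
have [k hk] := ltr_add_invr Zlt.
exists k => //; rewrite /off0/= in_itv/= => /andP[h1 _].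
by move: hk; rewrite -ltrBrDr sub0r ltNge (ltW h1).
Qed.

Let off0_nd : nondecreasing_seq off0.
Proof.
move=> m n mn; apply/subsetPset; apply: subsetC => y /=; rewrite !in_itv/=.
move=> /andP[h ->]; rewrite andbT; apply: le_lt_trans h.
by rewrite lerN2 lef_pV2 ?posrE ?ltr0n// ler_nat.
Qed.

Lemma cdf_neq0 (dT dT' : measure_display) (T : measurableType dT)
    (T' : measurableType dT') (P : probability T R) (P' : probability T' R)
    (Z : {RV P >-> R}) (Z' : {RV P' >-> R}) :
  (forall t, cdf Z t = cdf Z' t) ->
  P [set om | Z om != 0] = P' [set om | Z' om != 0].
Proof.
move=> h.
have off_cdf dU (U : measurableType dU) (Q : probability U R)
    (W : {RV Q >-> R}) k :
    Q (W @^-1` off0 k) = (1 - (cdf W 0 - cdf W (- k.+1%:R^-1)))%E.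
  rewrite /off0 -preimage_setC probability_setC; last first.
    by apply: rv_preimage_measurable.
  congr (_ - _)%E.
  rewrite /cdf /distribution /pushforward /=.
  pose H (y : R) := W @^-1` `]-oo, y]%classic.
  have mH y : measurable (H y) by apply: rv_preimage_measurable.
  have -> : Q (H (- k.+1%:R^-1)) = Q (H 0 `&` H (- k.+1%:R^-1)).
    congr (Q _); apply/seteqP; split => [om|om []//].
    rewrite /H /= !in_itv/= => h1.
    by split => //; apply: le_trans h1 _; rewrite oppr_le0.
  rewrite -measureD//; last first.
  - exact: le_lt_trans (probability_le1 _ (mH 0)) (ltry 1).
  - exact: mH.
  congr (Q _); apply/seteqP; split => om /=; rewrite !in_itv/=.
    by move=> /andP[h1 ->]; split => //; apply/negP; rewrite -ltNge.
  by move=> [-> /negP h1]; rewrite andbT ltNge.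
have lim dU (U : measurableType dU) (Q : probability U R) (W : {RV Q >-> R}) :
    Q (W @^-1` off0 k) @[k --> \oo] --> Q [set om | W om != 0].
  rewrite off0E; apply: nondecreasing_cvg_mu.
  - by move=> k; apply: rv_preimage_measurable.
  - by apply: bigcup_measurable => k _; apply: rv_preimage_measurable.
  - move=> m n mn; apply/subsetPset; apply: preimage_subset.
    exact/subsetPset/off0_nd.
have := lim _ _ _ Z.
have -> : (fun k => P (Z @^-1` off0 k)) = (fun k => P' (Z' @^-1` off0 k)).
  by apply/funext => k; rewrite !off_cdf !h.
by move=> /cvg_unique; apply => //; exact: lim.
Qed.

End CdfNeq0.

(** Fatou's lemma for events: the tail intersections increase to [L], and each has probability at
    most [e]. *)
Lemma liminf_measure_le (R : realType) (dT : measure_display)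
    (T : measurableType dT) (P : probability T R) (E : nat -> set T)
    (e : \bar R) :
  (forall n, measurable (E n)) -> (forall n, P (E n) <= e)%E ->
  let L := \bigcup_N \bigcap_(n in [set n | (N <= n)%N]) E n in
  measurable L /\ (P L <= e)%E.
Proof.
move=> mE Ee L.
have mI N : measurable (\bigcap_(n in [set n | (N <= n)%N]) E n).
  by apply: bigcap_measurableType.
have mL : measurable L by exact: bigcupT_measurable.
split => //.
have : P (\bigcap_(n in [set n | (N <= n)%N]) E n) @[N --> \oo] --> P L.
  apply: nondecreasing_cvg_mu => //.
  move=> m n mn; apply/subsetPset => om h k /= nk; apply: h => /=.
  exact: leq_trans nk.
move=> PL; apply: (cvge_to_le PL); apply: nearW => N.
apply: le_trans (Ee N); apply: le_measure; rewrite ?inE//.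
by move=> om; apply => /=.
Qed.

(** The game is seen as one with leaf variables constantly 0, so q = 0. A nonzero limit forces
    nonzero values, hence bad configurations, for all large n, except on the null event [N] where
    some cookie is not 1 or -1. *)
Lemma game_limit_neq0_le (R : realType) (d : nat) (hd : (15 <= d)%N)
    (dT : measure_display) (T : measurableType dT) (P : probability T R)
    (X : edge d -> {RV P >-> R}) : iid_cookies X ->
  (P [set om | game_limit (fun e => X e om) != 0%R] <= (bad_bound R d)%:E)%E.
Proof.
move=> hX; pose V (v : vertex d) : {RV P >-> R} := cst 0.
have V0 v : P [set om | V v om != 0] = 0%:E.
  rewrite (_ : [set _ | _] = set0) ?measure0//.
  by apply/seteqP; split => // om /=; rewrite /V eqxx.
pose E n := config_event X V (@game_bad d n).
have Vind n := @independent_family_cst0 R _ _ _ P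
  [set v : vertex d | size v = n.*2].
have VX n := @independent_of_cst0 R _ _ _ _ P [set v : vertex d | size v = n.*2]
  [set e : edge d | (size e.1 < n.*2)%N] X.
have bb0 : 0 <= bad_bound R d.
  by rewrite /bad_bound !mulr_ge0// invr_ge0 exprn_ge0.
have E_le n : (P (E n) <= (bad_bound R d)%:E)%E.
  apply: le_trans (config_event_le hX (Vind n) (VX n) (fun v _ => V0 v) _) _.
  rewrite lee_fin; apply: mass_game_bad => //.
  by rewrite lexx ler01.
have mE n : measurable (E n) by exact: config_event_measurable.
have [mL PL] := liminf_measure_le mE E_le; set L := \bigcup_N _ in mL PL.
have [N [mN PN0 HN]] := cookies_pm1 hX.
have mG : measurable [set om | game_limit (fun e => X e om) != 0].
  have := @measurable_game_limit R d _ T (fun om e => X e om)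
    (fun e => measurable_funP (X e)).
  move=> /(_ measurableT [set~ 0]); rewrite setTI => h.
  rewrite (_ : [set _ | _] =
    (fun om => game_limit (fun e => X e om)) @^-1` [set~ 0]).
    by apply: h; exact: measurableC.
  by apply/seteqP; split => om /= /eqP.
apply: (@le_trans _ _ (P (N `|` L))).
  apply: le_measure; rewrite ?inE//; first exact: measurableU.
  move=> om /= /game_limit_neq0 gl.
  have [pm1|npm1] := pselect (forall e, X e om = 1 \/ X e om = -1); last first.
    by left; apply: HN.
  right; have [M _ HM] := gl; exists M => // n /= Mn.
  rewrite /E /config_event /=.
  have := HM n Mn; rewrite /= game_valueE.
  apply: (config_bad (leq_trans _ hd : (0 < d)%N) pm1
    (U := fun k v => stopped_value (fun e => X e om) k.*2 v)) => //.
  exact: game_value_family.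
apply: le_trans (measureU2 _ mN mL) _.
have -> : (P N + P L = P L)%E by rewrite -[RHS]add0e; congr (_ + _)%E.
exact: PL.
Qed.

Lemma cookie_coordinate_measurable (R : realType) (d : nat) (e : edge d) :
  measurable_fun [set: cookie_space R d]
    (fun x : cookie_space R d => (x : edge d -> R) e).
Proof.
move=> _ B mB; rewrite setTI; apply: sub_sigma_algebra; exists e => //.
by exists B => //; rewrite setTI.
Qed.

(* (T0, P0, Y) carries the game that defines F_infty; (T, P, V, X) is any
   realization of the corresponding invariant recursive tree process. *)
Theorem corollary1p6 (R : realType) (d : nat) (hd : (15 <= d)%N)
    (dT0 : measure_display) (T0 : measurableType dT0) (P0 : probability T0 R)
    (Y : edge d -> {RV P0 >-> R}) (hY : iid_cookies Y)
    (dT : measure_display) (T : measurableType dT) (P : probability T R)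
    (V : vertex d -> {RV P >-> R}) (X : edge d -> {RV P >-> R})
    (hrtp : invariant_rtp (limit_cdf Y) V X) :
  endogenous V X.
Proof.
have [hX recV Vind Vcdf VX] := hrtp.
have mL : measurable_fun [set: T0] (fun om => game_limit (fun e => Y e om)).
  exact: (@measurable_game_limit R d _ T0 (fun om e => Y e om)
    (fun e => measurable_funP (Y e))).
pose L : {RV P0 >-> R} := mfun_Sub (mem_set mL).
(* Every V at an even level has the CDF of [L], hence the same probability q of being nonzero, and q
   inherits the bound proved for the game. *)
pose q := fine (P0 [set om | L om != 0]).
have qE n (v : vertex d) : size v = n.*2 -> P [set om | V v om != 0] = q%:E.
  move=> sv; rewrite /q fineK; last first.
    by rewrite fin_num_measure//; exact: rv_neq_measurable.
  by apply: cdf_neq0 => t; rewrite (Vcdf n).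
have q01 : 0 <= q <= 1.
  rewrite -!lee_fin -(qE 0 [::] erefl) measure_ge0/= probability_le1//.
  exact: rv_neq_measurable.
have q_bad : q <= bad_bound R d.
  rewrite -lee_fin /q fineK; first exact: (game_limit_neq0_le hd hY).
  by rewrite fin_num_measure//; exact: rv_neq_measurable.
pose E n := config_event X V (@game_diff d n).
have mE n : measurable (E n) by exact: config_event_measurable.
have E_le n : (P (E n) <= (2 ^- n)%:E)%E.
  apply: le_trans (config_event_le hX (Vind n) (VX n) (qE n) _) _.
  by rewrite lee_fin; apply: mass_game_diff.
(* Borel-Cantelli: 2^-n is written 2 / 2^(n+1), a series with sum at most 2. *)
have limsupE0 : P (lim_sup_set E) = 0.
  apply: lim_sup_set_cvg0 => //.
  apply: (@le_lt_trans _ _ (\sum_(n <oo) (2 / (2 ^ n.+1)%:R)%:E)%E).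
    apply: lee_nneseries => // n _; apply: le_trans (E_le n) _.
    by rewrite lee_fin natrX exprS invfM mulrA mulfV ?mul1r ?pnatr_eq0.
  exact: le_lt_trans (epsilon_trick0 _ _) (ltry 2).
(* The upper limit of the game values is a measurable function of the cookies, and equals V at the
   root as soon as the values are eventually equal to it. *)
exists (fun x => fine (limn_esup
  (fun n => (game_value (x : edge d -> R) n [::])%:E))).
split.
  apply: measurable_fine; apply: measurable_game_limsup.
  exact: cookie_coordinate_measurable.
have aeE : {ae P, forall om, ~ lim_sup_set E om}.
  exists (lim_sup_set E); split => //.
    by apply: bigcap_measurableType => n _; apply: bigcup_measurable.
  by move=> om /= /contrapT.
have pm1 := cookies_pm1 hX.
near=> om.
have pm1om : forall e, X e om = 1 \/ X e om = -1 by near: om.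
have recom : forall v : vertex d, ~~ odd (size v) ->
    V v om = round_value (fun e => X e om) (fun w => V w om) v by near: om.
have : ~ lim_sup_set E om by near: om.
move=> /existsNP[N /not_implyP[_ nE]].
have eqV n : (N <= n)%N -> game_value (fun e => X e om) n [::] = V [::] om.
  move=> Nn; apply/eqP; apply/negPn/negP => neq; apply: nE; exists n => //.
  rewrite /E /config_event /=; move: neq; rewrite game_valueE eq_sym.
  (* The leaf bits are the events that V is nonzero at level 2n; they cover the leaves of V by
     definition and those of the stopped game because these are 0. *)
  apply: (config_diff (leq_trans _ hd : (0 < d)%N) pm1om
    (U := fun k v => V v om)
    (U' := fun k v => stopped_value (fun e => X e om) k.*2 v)) => //.
  exact: game_value_family.
have uV : (fun n => (game_value (fun e => X e om) n [::])%:E) @ \oo -->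
    (V [::] om)%:E.
  apply: cvg_near_cst; exists N => // n /= Nn; congr EFin; exact: eqV.
by have [_ ->] := cvg_limn_einf_sup uV.
Unshelve. all: by end_near. Qed.
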